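(* The following equalities hold (as formal power series in $q$ with coefficients in $\mathbb{Q}[x]$): $$F(x,q) = (q^2;q^2)_\infty^3 \sum_{k=0}^\infty A_k(q^2)\,x^{2k+1}$$ and $$G(x,q) = \frac{(q;q)_\infty}{(-q;q)_\infty}\sum_{k=0}^\infty C_k(q)\,x^{2k}.$$
   Context: Notation: $(a;q)_\infty = \prod_{j=0}^\infty (1 - aq^j)$; thus $(q^2;q^2)_\infty=\prod_{j\ge 1}(1-q^{2j})$, $(q;q)_\infty=\prod_{j\ge1}(1-q^j)$ and $(-q;q)_\infty=\prod_{j\ge1}(1+q^j)$. $T_n$ denotes the Chebyshev polynomial of the first kind, defined by $T_n(\cos\theta)=\cos(n\theta)$. Set $$F(x,q) := 2\sum_{n=0}^\infty T_{2n+1}(\tfrac{1}{2}x)\,q^{n^2+n}, \qquad G(x,q) := 1+2\sum_{n=1}^\infty T_{2n}(\tfrac{1}{2}x)\,q^{n^2}.$$ MacMahon's generalized sum-of-divisors generating functions are, for integers $k\ge 1$ (sums over integers $m_1,\dots,m_k$), $$A_k(q) = \sum_{0<m_1 < \cdots < m_k}\frac{q^{m_1 + \cdots + m_k}}{(1 - q^{m_1})^2 \cdots (1 - q^{m_k})^2},$$ $$C_k(q) = \sum_{0<m_1 < \cdots < m_k}\frac{q^{2m_1 + \cdots +2m_k - k}}{(1 - q^{2m_1 - 1})^2 \cdots (1 - q^{2m_k - 1})^2},$$ with the convention $A_0(q)=C_0(q)=1$. $A_k(q^2)$ denotes $A_k$ with $q$ replaced by $q^2$. *)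

(* Defs.v *)
From HB Require Import structures.
From mathcomp Require Import all_boot all_order all_algebra.
From mathcomp Require Import boolp classical_sets functions cardinality fsbigop.
From mathcomp Require Import reals topology normedtype trigo.

Set Implicit Arguments.
Unset Strict Implicit.
Unset Printing Implicit Defensive.

Import Order.TTheory GRing.Theory Num.Theory.
Import numFieldNormedType.Exports.

Local Open Scope classical_set_scope.
Local Open Scope ring_scope.

(** * The ring R[[q]] of formal power series *)

Record fps (R : Type) := Fps { fps_coef : nat -> R }.

Notation "{ 'fps' R }" := (fps R) (format "{ 'fps'  R }") : type_scope.
Notation "f .@[ n ]" := (fps_coef f n)
  (at level 1, left associativity, format "f .@[ n ]") : ring_scope.

Lemma fpsP (R : Type) (f g : {fps R}) :
  (forall n, f.@[n] = g.@[n]) -> f = g.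
Proof. by case: f g => [f] [g] /= /funext ->. Qed.

HB.instance Definition _ (R : Type) := gen_eqMixin {fps R}.
HB.instance Definition _ (R : Type) := gen_choiceMixin {fps R}.

Section FpsRing.
Variable R : comNzRingType.
Implicit Types f g h : {fps R}.

Definition fps_zero : {fps R} := Fps (fun=> 0).
Definition fps_opp f : {fps R} := Fps (fun n => - f.@[n]).
Definition fps_add f g : {fps R} := Fps (fun n => f.@[n] + g.@[n]).
Definition fps_mul f g : {fps R} :=
  Fps (fun n => \sum_(i < n.+1) f.@[i] * g.@[n - i]).

Definition fpsC (c : R) : {fps R} := Fps (fun n => if n is 0 then c else 0).
Definition fpsX : {fps R} := Fps (fun n => (n == 1%N)%:R).

Fact fps_addA : associative fps_add.
Proof. by move=> f g h; apply: fpsP => n; rewrite /= addrA. Qed.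
Fact fps_addC : commutative fps_add.
Proof. by move=> f g; apply: fpsP => n; rewrite /= addrC. Qed.
Fact fps_add0 : left_id fps_zero fps_add.
Proof. by move=> f; apply: fpsP => n; rewrite /= add0r. Qed.
Fact fps_addN : left_inverse fps_zero fps_opp fps_add.
Proof. by move=> f; apply: fpsP => n; rewrite /= addNr. Qed.

HB.instance Definition _ :=
  GRing.isZmodule.Build {fps R} fps_addA fps_addC fps_add0 fps_addN.

Let trunc n f := \poly_(i < n.+1) f.@[i].

Let coef_trunc n f i : (i <= n)%N -> (trunc n f)`_i = f.@[i].
Proof. by move=> le_in; rewrite coef_poly ltnS le_in. Qed.

Let fps_mul_trunc n f g i : (i <= n)%N ->
  (fps_mul f g).@[i] = (trunc n f * trunc n g)`_i.
Proof.
move=> le_in; rewrite coefM /=; apply: eq_bigr => j _.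
by rewrite !coef_trunc // (leq_trans _ le_in) ?leq_subr // -ltnS.
Qed.

Fact fps_mulC : commutative fps_mul.
Proof.
by move=> f g; apply: fpsP => n; rewrite !(@fps_mul_trunc n) // mulrC.
Qed.

Fact fps_mulA : associative fps_mul.
Proof.
move=> f g h; apply: fpsP => n; transitivity (trunc n f * trunc n g * trunc n h)`_n.
  rewrite -mulrA coefM; apply: eq_bigr => i _.
  by rewrite coef_trunc -1?ltnS // (@fps_mul_trunc n) // leq_subr.
rewrite coefM; apply: eq_bigr => i _.
by rewrite (@fps_mul_trunc n) -1?ltnS // coef_trunc // leq_subr.
Qed.

Fact fps_mul1 : left_id (fpsC 1) fps_mul.
Proof.
move=> f; apply: fpsP => n /=; rewrite big_ord_recl /= subn0 mul1r.
by rewrite big1 ?addr0 // => i _; rewrite mul0r.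
Qed.

Fact fps_mulDl : left_distributive fps_mul fps_add.
Proof.
move=> f g h; apply: fpsP => n /=; rewrite -big_split /=.
by apply: eq_bigr => i _; rewrite mulrDl.
Qed.

Fact fps_1neq0 : fpsC 1 != 0.
Proof.
by apply/eqP => /(congr1 (fun f => f.@[0])) /= /eqP; rewrite oner_eq0.
Qed.

HB.instance Definition _ :=
  GRing.Zmodule_isComNzRing.Build {fps R}
    fps_mulA fps_mulC fps_mul1 fps_mulDl fps_1neq0.

Lemma coef_fps0 n : (0 : {fps R}).@[n] = 0. Proof. by []. Qed.
Lemma coef_fps1 n : (1 : {fps R}).@[n] = (n == 0%N)%:R. Proof. by case: n. Qed.
Lemma coef_fpsN f n : (- f).@[n] = - f.@[n]. Proof. by []. Qed.
Lemma coef_fpsD f g n : (f + g).@[n] = f.@[n] + g.@[n]. Proof. by []. Qed.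
Lemma coef_fpsB f g n : (f - g).@[n] = f.@[n] - g.@[n]. Proof. by []. Qed.
Lemma coef_fpsM f g n :
  (f * g).@[n] = \sum_(i < n.+1) f.@[i] * g.@[n - i].
Proof. by []. Qed.

Lemma coef_fps_sum (I : Type) (r : seq I) (P : pred I) (F : I -> {fps R}) n :
  (\sum_(i <- r | P i) F i).@[n] = \sum_(i <- r | P i) (F i).@[n].
Proof. exact: (big_morph (fun f => f.@[n])). Qed.

Lemma coef0_fpsM f g : (f * g).@[0] = f.@[0] * g.@[0].
Proof. by rewrite coef_fpsM big_ord1. Qed.

Lemma coef_fpsCM c f n : (fpsC c * f).@[n] = c * f.@[n].
Proof.
rewrite coef_fpsM big_ord_recl subn0 big1 ?addr0 // => i _.
by rewrite mul0r.
Qed.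

Lemma coef_fpsM_lt f g a b n :
    (forall i, (i < a)%N -> f.@[i] = 0) ->
    (forall i, (i < b)%N -> g.@[i] = 0) ->
  (n < a + b)%N -> (f * g).@[n] = 0.
Proof.
move=> f0 g0 ltn; rewrite coef_fpsM big1 // => i _.
have [/f0->|le_ai] := ltnP i a; first by rewrite mul0r.
rewrite g0 ?mulr0 // ltn_subLR; last by rewrite -ltnS.
by rewrite (leq_trans ltn) ?leq_add2r.
Qed.

Lemma coef_fpsX_lt f : f.@[0] = 0 ->
  forall k n, (n < k)%N -> (f ^+ k).@[n] = 0.
Proof.
move=> f0; elim=> // k IHk n lt_nk; rewrite exprS.
by apply: (@coef_fpsM_lt _ _ 1 k) => //; case.
Qed.

Lemma coef0_fpsX f k : (f ^+ k).@[0] = f.@[0] ^+ k.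
Proof. by elim: k => // k IHk; rewrite !exprS coef0_fpsM IHk. Qed.

End FpsRing.

Arguments fpsX {R}.

Notation "c %:S" := (fpsC c) (at level 1, left associativity, format "c %:S")
  : ring_scope.
Notation "''q'" := fpsX : ring_scope.

Section FpsUnitRing.
Variable R : comUnitRingType.
Implicit Types f g h : {fps R}.

Definition fps_unit : pred {fps R} := fun f => f.@[0] \is a GRing.unit.

(* f^-1 = c \sum_(i >= 0) (1 - c f)^i with c = f(0)^-1; only the terms i <= n
   contribute to the coefficient of q^n. *)
Definition fps_inv f : {fps R} :=
  if fps_unit f then
    let c := (f.@[0])^-1 in
    Fps (fun n => c * \sum_(i < n.+1) ((1 - c%:S * f) ^+ i).@[n])
  else f.

Fact fps_mulV : {in fps_unit, left_inverse 1 fps_inv *%R}.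
Proof.
move=> f Uf; rewrite /fps_inv ifT //; set c := (f.@[0])^-1.
have Uc : f.@[0] \is a GRing.unit by [].
set h := 1 - c%:S * f; pose S := Fps (fun n => \sum_(i < n.+1) (h ^+ i).@[n]).
have h0 : h.@[0] = 0 by rewrite coef_fpsB coef_fpsCM mulVr // subrr.
have -> : Fps (fun n => c * \sum_(i < n.+1) (h ^+ i).@[n]) = c%:S * S.
  by apply: fpsP => n; rewrite coef_fpsCM.
rewrite mulrAC; have -> : c%:S * f = 1 - h by rewrite opprB addrC subrK.
apply: fpsP => n; pose P := \sum_(i < n.+1) h ^+ i.
have SP j : (j <= n)%N -> S.@[j] = P.@[j].
  move=> le_jn; rewrite coef_fps_sum /=.
  rewrite -!(big_mkord xpredT (fun i => (h ^+ i).@[j])).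
  rewrite (big_cat_nat (n := j.+1) (p := n.+1)) //=.
  rewrite [X in _ = _ + X]big_nat [X in _ = _ + X]big1 ?addr0 // => i.
  by case/andP=> lt_ji _; rewrite coef_fpsX_lt.
transitivity (((1 - h) * P).@[n]).
  by rewrite !coef_fpsM; apply: eq_bigr => i _; rewrite SP // leq_subr.
rewrite -[1 - h]opprB mulNr -subrX1 opprB coef_fpsB.
by rewrite [X in _ - X]coef_fpsX_lt // subr0.
Qed.

Fact fps_unitP f g : g * f = 1 -> fps_unit f.
Proof.
move=> /(congr1 (fun f => f.@[0])); rewrite coef0_fpsM => gf1.
by apply/unitrP; exists g.@[0]; split; last rewrite mulrC.
Qed.

Fact fps_inv_out : {in [predC fps_unit], fps_inv =1 id}.
Proof. by move=> f /negbTE nUf; rewrite /fps_inv ifF. Qed.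

HB.instance Definition _ :=
  GRing.ComNzRing_hasMulInverse.Build {fps R} fps_mulV fps_unitP fps_inv_out.

Lemma fps_unitE f : (f \is a GRing.unit) = (f.@[0] \is a GRing.unit).
Proof. by []. Qed.

End FpsUnitRing.

(** * Infinite sums and products in R[[q]] *)

Section FpsLimits.
Variable R : comNzRingType.

(* A family is summable when only finitely many of its members contribute to
   each coefficient; outside this case fps_sum is not meaningful. *)
Definition fps_summable (I : choiceType) (A : set I) (f : I -> {fps R}) : Prop :=
  forall n, finite_set (A `&` [set i | (f i).@[n] != 0]).

Definition fps_sum (I : choiceType) (A : set I) (f : I -> {fps R}) : {fps R} :=
  Fps (fun n => \sum_(i \in A) (f i).@[n]).

Definition fps_cvg (u : nat -> {fps R}) (l : {fps R}) : Prop :=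
  forall n, exists N, forall k, (N <= k)%N -> (u k).@[n] = l.@[n].

Definition fps_lim (u : nat -> {fps R}) : {fps R} := xget 0 (fps_cvg u).

Lemma fps_cvg_lim (u : nat -> {fps R}) (l : {fps R}) : fps_cvg u l -> fps_lim u = l.
Proof.
move=> ul; apply: xget_unique => // l' ul'; apply: fpsP => n.
have [N HN] := ul n; have [N' HN'] := ul' n.
by rewrite -(HN (maxn N N')) ?leq_maxl // -(HN' (maxn N N')) // leq_maxr.
Qed.

Lemma fps_summable_nat (A : set nat) (f : nat -> {fps R}) :
  (forall k n, (n < k)%N -> (f k).@[n] = 0) -> fps_summable A f.
Proof.
move=> f0 n; apply: (sub_finite_set _ (finite_II n.+1)) => k [_ fkn0] /=.
by rewrite ltnS leqNgt; apply: contra fkn0 => /f0 ->.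
Qed.

Definition qpoch_inf (a y : {fps R}) : {fps R} :=
  fps_lim (fun N => \prod_(j < N) (1 - a * y ^+ j)).

Lemma qpoch_inf_cvg (a y : {fps R}) : y.@[0] = 0 ->
  fps_cvg (fun N => \prod_(j < N) (1 - a * y ^+ j)) (qpoch_inf a y).
Proof.
move=> y0; pose u N := \prod_(j < N) (1 - a * y ^+ j).
suff ul : fps_cvg u (Fps (fun n => (u n.+1).@[n])).
  by rewrite /qpoch_inf (fps_cvg_lim ul).
move=> n; exists n.+1; elim=> // k IHk.
rewrite leq_eqVlt => /predU1P[<- // | lt_nk]; rewrite -IHk //.
have -> : u k.+1 = u k - u k * a * y ^+ k.
  by rewrite /u big_ord_recr /= mulrBr mulr1 mulrA.
rewrite coef_fpsB.
by rewrite (@coef_fpsM_lt _ _ _ 0 k) ?subr0 // => i; apply: coef_fpsX_lt.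
Qed.

End FpsLimits.

Arguments fps_summable {R I} A f.
Arguments fps_sum {R I} A f.

(** * MacMahon's series *)

Section MacMahon.
Variable R : comUnitRingType.

(* {m : k.-tuple nat | 0 < m_1 < ... < m_k} *)
Definition chains (k : nat) : set (k.-tuple nat) :=
  [set m : k.-tuple nat | path ltn 0 m].

Arguments chains k : clear implicits.

(* The series are functions of y, so that A_k(q ^ 2) is macmahonA k ('q ^+ 2).
   For k = 0 the only chain is the empty one and both sums are equal to 1. *)
Definition termA (k : nat) (y : {fps R}) (m : k.-tuple nat) : {fps R} :=
  y ^+ (\sum_(i < k) tnth m i)%N / \prod_(i < k) (1 - y ^+ tnth m i) ^+ 2.

Definition macmahonA (k : nat) (y : {fps R}) : {fps R} :=
  fps_sum (chains k) (@termA k y).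

(* The natural subtractions do not truncate on chains, since every m_i >= 1. *)
Definition termC (k : nat) (y : {fps R}) (m : k.-tuple nat) : {fps R} :=
  y ^+ ((\sum_(i < k) 2 * tnth m i) - k)%N /
  \prod_(i < k) (1 - y ^+ (2 * tnth m i - 1)%N) ^+ 2.

Definition macmahonC (k : nat) (y : {fps R}) : {fps R} :=
  fps_sum (chains k) (@termC k y).

Lemma chains_gt0 k (m : k.-tuple nat) i : chains k m -> (0 < tnth m i)%N.
Proof.
rewrite /chains /= (path_sortedE ltn_trans) => /andP[/allP m_gt0 _].
by apply: m_gt0; apply: mem_tnth.
Qed.

Lemma finite_bounded_tuples k (A : set (k.-tuple nat)) n :
  (forall m, A m -> forall i, (tnth m i <= n)%N) -> finite_set A.
Proof.
move=> Abnd; pose f (t : k.-tuple 'I_n.+1) : k.-tuple nat := [tuple of map val t].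
apply: (@sub_finite_set _ _ (range f)); last exact/finite_image/finite_finset.
move=> m Am; exists [tuple inord (tnth m i) | i < k] => //.
by apply: eq_from_tnth => i; rewrite tnth_map tnth_mktuple /= inordK // ltnS Abnd.
Qed.

Lemma termA_summable k (y : {fps R}) : y.@[0] = 0 ->
  fps_summable (chains k) (@termA k y).
Proof.
move=> y0 n; apply: (@finite_bounded_tuples _ _ n) => m [_ mn0] i.
have {mn0} : (termA y m).@[n] != 0 by [].
rewrite leqNgt; apply: contra => lt_nm; apply/eqP.
rewrite /termA (@coef_fpsM_lt _ _ _ (\sum_(i < k) tnth m i) 0) //.
  by move=> j; apply: coef_fpsX_lt.
by rewrite addn0 (leq_trans lt_nm) // (bigD1 i) //= leq_addr.
Qed.

Lemma termC_summable k (y : {fps R}) : y.@[0] = 0 ->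
  fps_summable (chains k) (@termC k y).
Proof.
move=> y0 n; apply: (@finite_bounded_tuples _ _ n) => m [m_chain mn0] i.
have {mn0} : (termC y m).@[n] != 0 by [].
rewrite leqNgt; apply: contra => lt_nm; apply/eqP.
rewrite /termC (@coef_fpsM_lt _ _ _ (\sum_(i < k) 2 * tnth m i - k) 0) //.
  by move=> j; apply: coef_fpsX_lt.
rewrite addn0 (leq_trans lt_nm) // leq_subRL; last first.
  rewrite -[X in (X <= _)%N]card_ord -sum1_card leq_sum // => j _.
  by rewrite muln_gt0 chains_gt0.
have -> : (\sum_(j < k) 2 * tnth m j
         = \sum_(j < k) tnth m j + \sum_(j < k) tnth m j)%N.
  by rewrite -big_split /=; apply: eq_bigr => j _; rewrite mul2n -addnn.
rewrite leq_add //; last by rewrite (bigD1 i) //= leq_addr.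
rewrite -[X in (X <= _)%N]card_ord -sum1_card leq_sum // => j _.
exact: chains_gt0.
Qed.

Lemma macmahonA_lt k (y : {fps R}) n : y.@[0] = 0 -> (n < k)%N ->
  (macmahonA k y).@[n] = 0.
Proof.
move=> y0 lt_nk; apply: fsbig1 => m m_chain.
rewrite /termA (@coef_fpsM_lt _ _ _ (\sum_(i < k) tnth m i) 0) //.
  by move=> j; apply: coef_fpsX_lt.
rewrite addn0 (leq_trans lt_nk) // -[X in (X <= _)%N]card_ord -sum1_card.
by rewrite leq_sum // => j _; apply: chains_gt0.
Qed.

Lemma macmahonC_lt k (y : {fps R}) n : y.@[0] = 0 -> (n < k)%N ->
  (macmahonC k y).@[n] = 0.
Proof.
move=> y0 lt_nk; apply: fsbig1 => m m_chain.
rewrite /termC (@coef_fpsM_lt _ _ _ ((\sum_(i < k) (2 * tnth m i)) - k) 0) //.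
  by move=> j; apply: coef_fpsX_lt.
rewrite addn0 (leq_trans lt_nk) // leq_subRL.
  rewrite addnn -mul2n mulnC -[X in (X * _ <= _)%N]card_ord -sum_nat_const.
  by rewrite leq_sum // => j _; rewrite leq_pmulr ?chains_gt0.
rewrite -[X in (X <= _)%N]card_ord -sum1_card leq_sum // => j _.
by rewrite muln_gt0 chains_gt0.
Qed.

Lemma macmahon_den_unit (y : {fps R}) d : y.@[0] = 0 -> (0 < d)%N ->
  1 - y ^+ d \is a GRing.unit.
Proof.
by move=> y0 d0; rewrite fps_unitE coef_fpsB coef_fpsX_lt // subr0 unitr1.
Qed.

Lemma chains0 : chains 0 = [set nil_tuple nat].
Proof. by apply/seteqP; split=> m; rewrite [m]tuple0. Qed.

Lemma macmahonA0 (y : {fps R}) : macmahonA 0 y = 1.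
Proof.
apply: fpsP => n; rewrite /= -[LHS]/(\sum_(m \in chains 0) (termA y m).@[n]).
by rewrite chains0 fsbig_set1 /termA !big_ord0 divr1.
Qed.

Lemma macmahonC0 (y : {fps R}) : macmahonC 0 y = 1.
Proof.
apply: fpsP => n; rewrite /= -[LHS]/(\sum_(m \in chains 0) (termC y m).@[n]).
by rewrite chains0 fsbig_set1 /termC !big_ord0 divr1.
Qed.

End MacMahon.

(** * Chebyshev polynomials of the first kind *)

Section Chebyshev.
Variable R : realType.

Definition is_chebyshevT (n : nat) (p : {poly rat}) : Prop :=
  forall theta : R, (map_poly ratr p).[cos theta] = cos (n%:R * theta).

Definition chebyshevT (n : nat) : {poly rat} := xget 0 (is_chebyshevT n).

Lemma chebyshevTP n : is_chebyshevT n (chebyshevT n).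
Proof.
suff [p [_ [pP _]]] : exists p q, is_chebyshevT n p /\ is_chebyshevT n.+1 q.
  by apply: xgetPex; exists p.
elim: n => [|n [p [q [pP qP]]]].
  exists 1, 'X; split=> theta; first by rewrite rmorph1 hornerE mul0r cos0.
  by rewrite map_polyX hornerX mul1r.
exists q, (2%:R *: ('X * q) - p); split=> // theta.
rewrite rmorphB /= map_polyZ rmorphM /= map_polyX hornerD hornerN hornerZ.
rewrite hornerM hornerX qP pP rmorph_nat.
have -> : n.+2%:R * theta = n.+1%:R * theta + theta.
  by rewrite -[n.+2]addn1 natrD mulrDl mul1r.
have -> : n%:R * theta = n.+1%:R * theta - theta.
  by rewrite -[n.+1]addn1 natrD mulrDl mul1r addrK.
rewrite cosB cosD mulr2n mulrDl mul1r [cos theta * _]mulrC opprD addrA.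
by rewrite addrK.
Qed.

Definition seriesF : {fps {poly rat}} :=
  2%:R * fps_sum [set: nat] (fun n =>
    (chebyshevT (2 * n + 1) \Po (2^-1 *: 'X))%:S * 'q ^+ (n ^ 2 + n)).

Definition seriesG : {fps {poly rat}} :=
  1 + 2%:R * fps_sum [set n : nat | (1 <= n)%N] (fun n =>
    (chebyshevT (2 * n) \Po (2^-1 *: 'X))%:S * 'q ^+ (n ^ 2)).

End Chebyshev.

(* Main.v *)
Require Import Defs.
From mathcomp Require Import all_boot all_order all_algebra.
From mathcomp Require Import boolp classical_sets functions fsbigop.
From mathcomp Require Import reals trigo.
From mathcomp Require Import zify ring.

Import Order.TTheory GRing.Theory Num.Theory.
Local Open Scope classical_set_scope.
Local Open Scope ring_scope.

(** Write x = z + z^-1, so that 2 T_n (x / 2) = z^n + z^-n.  Then both series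
    are bilateral theta series: the first is the sum over n in Z of
    z^(2n+1) q^(n^2+n), the second the sum of z^(2n) q^(n^2).  The Jacobi triple
    product turns them into products with the factors
    (1 + z^2 q^a) (1 + z^-2 q^a) = (1 - q^a)^2 + x^2 q^a
                                 = (1 - q^a)^2 (1 + x^2 q^a / (1 - q^a)^2),
    where a runs over the positive even numbers for the first series and over
    the odd ones for the second.  Expanding the product of the factors
    1 + x^2 w_a with w_a = q^a / (1 - q^a)^2 in powers of x^2 gives the
    elementary symmetric functions of the w_a, and these are MacMahon's sums.

    The variable z stays out of the formal argument.  In its place comes a
    finite triple product, in which z^d is replaced by T_|d| (x / 2):
    [theta_sum m] is the sum over 0 <= k <= m of
    [m choose k]_(q^2) q^(floor (d^2 / 4)) T_|d| (x / 2) with d = 2k - m.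
    The two q-Pascal rules, used once each, and the product formula for
    Chebyshev polynomials show that passing from m to m + 2 multiplies it by the
    factor of index a = m + 1 ([theta_sumSS], [triple_factor]); even m lead to
    the second series and odd m to the first.

    The limit m -> oo is taken modulo q^n for each n.  The product of
    (q^2;q^2)_oo and a Gaussian binomial coefficient is 1 modulo q^n unless k is
    within n of an end of [0, m], and there the power of q in the summand is
    already at least n ([eqmodq_theta_sum]).  On the product side, the finite products are
    expanded over subsets of {1, ..., N}, which are the chains bounded by N
    ([eqmodq_prod_chain_sum]), and
    (q^2;q^2)_oo (q;q^2)_oo^2 = (q;q)_oo / (-q;q)_oo ([eqmodq_odd_qfact]). *)

Set Implicit Arguments.
Unset Strict Implicit.
Unset Printing Implicit Defensive.

(** * Constant power series *)

Section ConstantSeries.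
Variable R : comNzRingType.

Lemma fpsCD (c d : R) : (c + d)%:S = c%:S + d%:S :> {fps R}.
Proof. by apply: fpsP => -[|n] //=; rewrite addr0. Qed.

Lemma fpsCN (c : R) : (- c)%:S = - c%:S :> {fps R}.
Proof. by apply: fpsP => -[|n] //=; rewrite oppr0. Qed.

Lemma fpsCM (c d : R) : (c * d)%:S = c%:S * d%:S :> {fps R}.
Proof. by apply: fpsP => -[|n]; rewrite coef_fpsCM //= mulr0. Qed.

Lemma fpsCX (c : R) n : (c ^+ n)%:S = c%:S ^+ n :> {fps R}.
Proof. by elim: n => // n IHn; rewrite !exprS fpsCM IHn. Qed.

Lemma fpsCMn (c : R) n : (c *+ n)%:S = c%:S *+ n :> {fps R}.
Proof.
elim: n => [|n IHn]; first by apply: fpsP => -[].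
by rewrite !mulrS fpsCD IHn.
Qed.

End ConstantSeries.

(** * Congruences of power series modulo powers of q *)

Section Congruence.
Variable R : comNzRingType.
Implicit Types f g h : {fps R}.

Definition eqmodq (n : nat) f g : Prop := forall i, (i < n)%N -> f.@[i] = g.@[i].

Lemma eqmodq_refl n f : eqmodq n f f. Proof. by []. Qed.

Lemma eqmodq_sym n f g : eqmodq n f g -> eqmodq n g f.
Proof. by move=> fg i /fg. Qed.

Lemma eqmodq_trans n g f h : eqmodq n f g -> eqmodq n g h -> eqmodq n f h.
Proof. by move=> fg gh i lt_in; rewrite fg // gh. Qed.

Lemma eqmodq_leq m n f g : (m <= n)%N -> eqmodq n f g -> eqmodq m f g.
Proof. by move=> le_mn fg i lt_im; apply: fg; apply: leq_trans le_mn. Qed.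

Lemma eqmodqP f g : (forall n, eqmodq n f g) -> f = g.
Proof. by move=> fg; apply: fpsP => n; apply: (fg n.+1). Qed.

Lemma eqmodqD n f f' g g' :
  eqmodq n f f' -> eqmodq n g g' -> eqmodq n (f + g) (f' + g').
Proof. by move=> ff' gg' i lt_in; rewrite !coef_fpsD ff' ?gg'. Qed.

Lemma eqmodqM n f f' g g' :
  eqmodq n f f' -> eqmodq n g g' -> eqmodq n (f * g) (f' * g').
Proof.
move=> ff' gg' i lt_in; rewrite !coef_fpsM; apply: eq_bigr => j _.
rewrite ff' ?gg' //; first by rewrite (leq_ltn_trans (leq_subr _ _)).
by rewrite (leq_trans (ltn_ord j)).
Qed.

Lemma eqmodqX n f g k : eqmodq n f g -> eqmodq n (f ^+ k) (g ^+ k).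
Proof. by move=> fg; elim: k => // k IHk; rewrite !exprS; apply: eqmodqM. Qed.

Lemma eqmodq_sum n (I : Type) (r : seq I) (P : pred I) (F G : I -> {fps R}) :
  (forall i, P i -> eqmodq n (F i) (G i)) ->
  eqmodq n (\sum_(i <- r | P i) F i) (\sum_(i <- r | P i) G i).
Proof.
move=> FG i lt_in; rewrite !coef_fps_sum.
by apply: eq_bigr => j Pj; apply: FG.
Qed.

Lemma eqmodq0M n f g : eqmodq n f 0 -> eqmodq n (f * g) 0.
Proof. by move=> f0; rewrite -[0](mul0r g); apply: eqmodqM. Qed.

Lemma eqmodqXn0 n y k : y.@[0] = 0 -> (n <= k)%N -> eqmodq n (y ^+ k) (0 : {fps R}).
Proof.
by move=> y0 le_nk i lt_in; rewrite coef_fpsX_lt // (leq_trans lt_in).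
Qed.

(** Bridges an infinite sum indexed by an arbitrary set of naturals and a finite
    big operator: when the k-th summand has order at least k, only the first M
    of them are visible modulo q^M. *)
Lemma eqmodq_fps_sum (A : set nat) (f : nat -> {fps R}) (M : nat) :
    (forall k n, (n < k)%N -> (f k).@[n] = 0) ->
  eqmodq M (fps_sum A f) (\sum_(k < M | (k : nat) \in A) f k).
Proof.
move=> f0 i lt_iM; rewrite coef_fps_sum /=.
rewrite -(big_mkord (fun k => k \in A) (fun k => (f k).@[i])).
rewrite [RHS]bigfs ?iota_uniq //=; first by apply: eq_fsbigl; rewrite set_mem_set.
move=> k _; rewrite mem_index_iota /= -leqNgt => le_Mk; apply: f0; exact: leq_trans le_Mk.
Qed.

(** A quantitative form of the convergence of the product: the j-th factor is
    1 modulo y^j, so that the factors from N on do not affect the coefficients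
    below q^N. *)
Lemma eqmodq_qpoch_inf (a y : {fps R}) N : y.@[0] = 0 ->
  eqmodq N (qpoch_inf a y) (\prod_(j < N) (1 - a * y ^+ j)).
Proof.
move=> y0 i lt_iN; have [M /(_ (maxn M N)) <-] := qpoch_inf_cvg a y0 i;
  last exact: leq_maxl.
have: (N <= maxn M N)%N by apply: leq_maxr.
elim: (maxn M N) => [|k IHk]; first by rewrite leqn0 => /eqP->.
rewrite leq_eqVlt => /predU1P[-> // | le_Nk].
have -> : \prod_(j < k.+1) (1 - a * y ^+ j)
       = \prod_(j < k) (1 - a * y ^+ j) - y ^+ k * (a * \prod_(j < k) (1 - a * y ^+ j)).
  by rewrite big_ord_recr /=; ring.
rewrite coef_fpsB IHk // (@eqmodq0M k) ?subr0 //; first exact: eqmodqXn0.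
exact: leq_trans lt_iN le_Nk.
Qed.

End Congruence.

Lemma eqmodq_cancel (R : comUnitRingType) n (f g h : {fps R}) :
  f \is a GRing.unit -> eqmodq n (f * g) (f * h) -> eqmodq n g h.
Proof.
by move=> Uf /(eqmodqM (@eqmodq_refl _ n f^-1)); rewrite !mulKr.
Qed.

(** * Gaussian binomial coefficients *)

Section QBinomial.
Variables (R : comNzRingType) (p : R).

(** The Gaussian binomial coefficient in base p, defined by the q-Pascal rule in
    order to make sense in any commutative ring. *)
Fixpoint qbin (m k : nat) : R :=
  match m, k with
  | _, 0 => 1
  | 0, _.+1 => 0
  | m'.+1, k'.+1 => qbin m' k' + p ^+ k'.+1 * qbin m' k'.+1
  end.

(** The finite product (p;p)_n. *)
Definition qfact (n : nat) : R := \prod_(j < n) (1 - p * p ^+ j).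

Lemma qbin0 m : qbin m 0 = 1. Proof. by case: m. Qed.

Lemma qbinS m k : qbin m.+1 k.+1 = qbin m k + p ^+ k.+1 * qbin m k.+1.
Proof. by []. Qed.

Lemma qbin_small m k : (m < k)%N -> qbin m k = 0.
Proof.
elim: m k => [|m IHm] [|k] //; rewrite ltnS => lt_mk.
by rewrite qbinS !IHm ?mulr0 ?addr0 // ltnW.
Qed.

(** The other q-Pascal rule, the image of the defining one under the symmetry
    k -> m - k.  For k > m the truncated exponent is harmless, since the
    coefficient next to it vanishes. *)
Lemma qbinSr m k : qbin m.+1 k.+1 = qbin m k.+1 + p ^+ (m - k) * qbin m k.
Proof.
elim: m k => [|m IHm] [|k].
- by rewrite /= subn0 expr0 mulr0 addr0 add0r mulr1.
- by rewrite /= !mulr0 !addr0.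
- by rewrite [LHS]qbinS [in LHS]IHm qbinS !qbin0 !subn0 !exprS; ring.
rewrite [LHS]qbinS [in LHS]IHm [X in _ + _ * X]IHm !qbinS subSS.
have [lt_km | le_mk] := ltnP k m; last by rewrite (@qbin_small m k.+1) //; ring.
have <- : (k + (m - k.+1).+1 = m)%N by lia.
have -> : (k + (m - k.+1).+1 - k.+1 = m - k.+1)%N by lia.
have -> : (k + (m - k.+1).+1 - k = (m - k.+1).+1)%N by lia.
by rewrite !exprS; ring.
Qed.

Lemma qfact0 : qfact 0 = 1. Proof. by rewrite /qfact big_ord0. Qed.

Lemma qfactS n : qfact n.+1 = qfact n * (1 - p ^+ n.+1).
Proof. by rewrite /qfact big_ord_recr /= -exprS. Qed.

(** The quotient formula for Gaussian binomials, kept free of divisions. *)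
Lemma qbin_qfact m k : (k <= m)%N -> qfact k * qfact (m - k) * qbin m k = qfact m.
Proof.
elim: m k => [|m IHm] [|k] le_km //; rewrite ?qbin0.
- by rewrite qfact0 !mulr1.
- by rewrite qfact0 mul1r mulr1.
rewrite subSS qbinS qfactS mulrDr.
have -> : qfact k * (1 - p ^+ k.+1) * qfact (m - k) * qbin m k
       = (1 - p ^+ k.+1) * qfact m by rewrite -(IHm k) //; ring.
move: le_km; rewrite ltnS leq_eqVlt => /predU1P[-> | lt_km].
  by rewrite (@qbin_small m) // qfactS; ring.
rewrite qfactS -(IHm k.+1) // qfactS.
have -> : (m - k = (m - k.+1).+1)%N by lia.
rewrite qfactS; have -> : p ^+ m.+1 = p ^+ k.+1 * p ^+ (m - k.+1).+1.
  by rewrite -exprD; congr (_ ^+ _); lia.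
ring.
Qed.

(** The q-Pascal rules, transposed to the weights f of a sum: this form lets two
    steps in m be composed without splitting off boundary terms. *)
Lemma sum_qbinS m (f : nat -> R) :
  \sum_(k < m.+2) qbin m.+1 k * f k
  = \sum_(k < m.+1) qbin m k * (p ^+ k * f k + f k.+1).
Proof.
rewrite big_ord_recl qbin0 mul1r.
under eq_bigr => k _ do rewrite lift0 qbinS mulrDl.
rewrite big_split /= addrCA.
under [RHS]eq_bigr => k _ do rewrite mulrDr addrC.
rewrite big_split /=; congr (_ + _).
rewrite big_ord_recr /= qbin_small // mulr0 mul0r addr0.
rewrite [RHS]big_ord_recl /= qbin0 expr0 !mul1r; congr (_ + _).
by apply: eq_bigr => k _; rewrite /bump leq0n add1n; ring.
Qed.

Lemma sum_qbinSr m (f : nat -> R) :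
  \sum_(k < m.+2) qbin m.+1 k * f k
  = \sum_(k < m.+1) qbin m k * (f k + p ^+ (m - k) * f k.+1).
Proof.
rewrite big_ord_recl qbin0 mul1r.
under eq_bigr => k _ do rewrite lift0 qbinSr mulrDl.
rewrite big_split /= addrA.
under [RHS]eq_bigr => k _ do rewrite mulrDr.
rewrite big_split /=; congr (_ + _); last by apply: eq_bigr => k _; ring.
rewrite big_ord_recr /= qbin_small // mul0r addr0.
by rewrite [RHS]big_ord_recl /= qbin0 mul1r; congr (_ + _).
Qed.

End QBinomial.

(** The finite product (q;q^2)_N. *)
Definition odd_qfact (R : comNzRingType) (N : nat) : {fps R} :=
  \prod_(j < N) (1 - 'q ^+ (2 * j).+1).

(** * Chebyshev polynomials *)

Section ChebyshevTheory.
Variable R : realType.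

(** Cosines take infinitely many values, so identities between rational
    polynomials can be checked as trigonometric identities. *)
Lemma poly_cos_inj (p q : {poly rat}) :
  (forall theta : R, (map_poly ratr p).[cos theta] = (map_poly ratr q).[cos theta]) ->
  p = q.
Proof.
move=> pq; apply: (@map_poly_inj _ _ (@ratr R)); apply/eqP; rewrite -subr_eq0.
set d := _ - _.
(* More roots than the degree allows: 1, 1/2, 1/3, ... are all cosines. *)
pose rs := [seq (k.+1%:R : R)^-1 | k <- iota 0 (size d)].
apply/eqP; apply: (@roots_geq_poly_eq0 _ d rs); last by rewrite size_map size_iota.
  apply/allP => _ /mapP[k _ ->]; rewrite /root hornerD hornerN.
  have k1 : -1 <= (k.+1%:R : R)^-1 <= 1.
    rewrite invf_le1 ?ltr0n // ler1n andbT.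
    by rewrite (@le_trans _ _ 0) ?invr_ge0 ?ler0n // lerN10.
  by rewrite -[_^-1]acosK ?in_itv //= pq subrr.
rewrite map_inj_uniq ?iota_uniq // => i j /invr_inj/eqP.
by rewrite eqr_nat eqSS => /eqP.
Qed.

(** Extends T to negative indices by the parity of the cosine; on all of Z the
    product formulas hold without case distinctions. *)
Definition chebz (d : int) : {poly rat} := chebyshevT R `|d|%N.

Lemma chebzP (d : int) (theta : R) :
  (map_poly ratr (chebz d)).[cos theta] = cos (d%:~R * theta).
Proof.
rewrite chebyshevTP; case: (intP d) => [|n|n] //.
by rewrite rmorphN mulNr cosN abszN.
Qed.

(** This is cos (a + b) + cos (a - b) = 2 cos a cos b with b = 2 theta, where
    2 cos (2 theta) = 4 cos^2 theta - 2. *)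
Lemma chebz_add2 (d : int) :
  chebz (d + 2) + chebz (d - 2) = (4%:R *: 'X^2 - 2%:R) * chebz d.
Proof.
apply: poly_cos_inj => theta.
rewrite rmorphD rmorphM rmorphB /= map_polyZ map_polyXn !rmorph_nat -polyC_natr.
rewrite hornerM !hornerD hornerN hornerZ hornerXn hornerC !chebzP.
have -> : (d + 2)%:~R * theta = d%:~R * theta + (theta + theta) by ring.
have -> : (d - 2)%:~R * theta = d%:~R * theta - (theta + theta) by ring.
rewrite cosB !cosD -[sin theta * sin theta]expr2 sin2cos2.
by ring.
Qed.

(** In terms of x = z + z^-1 this is (z^d + z^-d) / 2, the part of z^d that is
    invariant under z -> z^-1. *)
Definition chebhalf (d : int) : {poly rat} := chebz d \Po (2^-1 *: 'X).

Lemma chebhalf0 : chebhalf 0 = 1.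
Proof.
rewrite /chebhalf (_ : chebz 0 = 1) ?comp_polyC //.
by apply: poly_cos_inj => theta; rewrite chebzP rmorph1 hornerC mulr0z mul0r cos0.
Qed.

Lemma chebhalf1 : chebhalf 1 = 2^-1 *: 'X.
Proof.
rewrite /chebhalf (_ : chebz 1 = 'X) ?comp_polyX //.
by apply: poly_cos_inj => theta; rewrite chebzP map_polyX hornerX mulr1z mul1r.
Qed.

Lemma chebhalfN d : chebhalf (- d) = chebhalf d.
Proof. by rewrite /chebhalf /chebz abszN. Qed.

Lemma chebhalf_add2 (d : int) :
  chebhalf (d + 2) + chebhalf (d - 2) = ('X^2 - 2%:R) * chebhalf d.
Proof.
rewrite /chebhalf -rmorphD /= chebz_add2 rmorphM rmorphB /=; congr (_ * _).
rewrite linearZ /= comp_Xn_poly exprZn scalerA rmorph_nat.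
by rewrite (_ : 4%:R * _ = 1) ?scale1r.
Qed.

End ChebyshevTheory.

(** * The finite triple product *)

Section TripleProduct.
Variable R : realType.
Local Notation fpoly := {fps {poly rat}}.

(** Replaces z^d q^(floor (d^2 / 4)).  For d = 2n the exponent of q is n^2 and for
    d = 2n + 1 it is n^2 + n, so a single family serves both series. *)
Definition theta_term (d : int) : fpoly :=
  'q ^+ (`|d| ^ 2 %/ 4) * (chebhalf R d)%:S.

(** The expanded side of the finite triple product.  The q-binomial theorem gives
    the product of the (1 + z^2 q^a) (1 + z^-2 q^a) over the a < m of parity
    opposite to that of m, with a > 0, times z + z^-1 when m is odd. *)
Definition theta_sum (m : nat) : fpoly :=
  \sum_(k < m.+1) qbin ('q ^+ 2) m k * theta_term ((2 * k)%:Z - m%:Z).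

Lemma Posz_absz_sqr (z : int) : (`|z| ^ 2)%N = z ^+ 2 :> int.
Proof. by rewrite -mulnn PoszM abszE -normrM ger0_norm -expr2 ?sqr_ge0. Qed.

(** With d = 2k - m, shifting d by -2 or +2 changes floor (d^2 / 4) by 1 - d or
    1 + d; the powers of p = q^2 in the q-Pascal rules compensate for the
    dependence on d.  Both identities are read off after multiplication by 4. *)
Lemma theta_exponent_down (m k : nat) :
  (2 * k + `|((2 * k)%:Z - m%:Z - 2)%R| ^ 2 %/ 4
   = m.+1 + `|((2 * k)%:Z - m%:Z)%R| ^ 2 %/ 4)%N.
Proof.
rewrite -!(divnMDl _ _ (isT : 0 < 4)%N); congr (_ %/ _)%N; apply/eqP.
by rewrite -eqz_nat !PoszD !Posz_absz_sqr !PoszM; apply/eqP; ring.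
Qed.

Lemma theta_exponent_up (m k : nat) : (k <= m)%N ->
  (2 * (m - k) + `|((2 * k)%:Z - m%:Z + 2)%R| ^ 2 %/ 4
   = m.+1 + `|((2 * k)%:Z - m%:Z)%R| ^ 2 %/ 4)%N.
Proof.
move=> le_km; rewrite -!(divnMDl _ _ (isT : 0 < 4)%N); congr (_ %/ _)%N; apply/eqP.
by rewrite -eqz_nat !PoszD !Posz_absz_sqr !PoszM -subzn //; apply/eqP; ring.
Qed.

(** One q-Pascal rule lowers m + 2 to m + 1 and the other lowers m + 1 to m.  The
    summand of index k then collects the terms d - 2, d and d + 2 with d = 2k - m:
    the outer two carry the same power of q and combine by the product formula
    for Chebyshev polynomials. *)
Lemma theta_sumSS (m : nat) :
  theta_sum m.+2
  = theta_sum m * (1 + 'q ^+ (2 * m.+1) + 'q ^+ m.+1 * ('X^2 - 2%:R)%:S).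
Proof.
rewrite /theta_sum (sum_qbinS _ m.+1 (fun k => theta_term ((2 * k)%:Z - m.+2%:Z))).
rewrite (sum_qbinSr _ m (fun k => ('q ^+ 2) ^+ k * theta_term ((2 * k)%:Z - m.+2%:Z)
   + theta_term ((2 * k.+1)%:Z - m.+2%:Z))) mulr_suml.
apply: eq_bigr => -[k /=]; rewrite ltnS => le_km _; rewrite -mulrA; congr (_ * _).
set d : int := (2 * k)%:Z - m%:Z.
have -> : (2 * k)%:Z - m.+2%:Z = d - 2 by rewrite /d; lia.
have -> : (2 * k.+1)%:Z - m.+2%:Z = d by rewrite /d; lia.
have -> : (2 * k.+2)%:Z - m.+2%:Z = d + 2 by rewrite /d; lia.
have down : ('q ^+ 2) ^+ k * theta_term (d - 2)
          = 'q ^+ m.+1 * 'q ^+ (`|d| ^ 2 %/ 4) * (chebhalf R (d - 2))%:S.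
  by rewrite /theta_term mulrA -exprM -!exprD theta_exponent_down.
have up : ('q ^+ 2) ^+ (m - k) * theta_term (d + 2)
        = 'q ^+ m.+1 * 'q ^+ (`|d| ^ 2 %/ 4) * (chebhalf R (d + 2))%:S.
  by rewrite /theta_term mulrA -exprM -!exprD theta_exponent_up.
have mid : ('q ^+ 2) ^+ (m - k) * ('q ^+ 2) ^+ k.+1 = 'q ^+ (2 * m.+1) :> fpoly.
  by rewrite -exprD -exprM; congr (_ ^+ (_ * _)); lia.
rewrite mulrDr up [_ * (_ ^+ k.+1 * _)]mulrA mid down.
have cheb2 : (chebhalf R (d + 2))%:S + (chebhalf R (d - 2))%:S
     = ('X^2 - 2%:R)%:S * (chebhalf R d)%:S :> fpoly.
  by rewrite -fpsCD chebhalf_add2 fpsCM.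
set Q := 'q ^+ m.+1; set Q2 := 'q ^+ (2 * m.+1); set Q' := 'q ^+ (_ %/ _).
transitivity (theta_term d * (1 + Q2) + Q * Q' *
   ((chebhalf R (d + 2))%:S + (chebhalf R (d - 2))%:S)); first by ring.
by rewrite cheb2 /theta_term -/Q'; ring.
Qed.

(** The contribution of a single part a to MacMahon's sums. *)
Definition part_weight (a : nat) : fpoly := 'q ^+ a / (1 - 'q ^+ a) ^+ 2.

(** The point where x^2 - 2 = z^2 + z^-2 turns into x^2 and the square
    (1 - q^a)^2 that completes it. *)
Lemma triple_factor (a : nat) : (0 < a)%N ->
  1 + 'q ^+ (2 * a) + 'q ^+ a * ('X^2 - 2%:R)%:S
  = (1 - 'q ^+ a) ^+ 2 * (1 + ('X^2)%:S * part_weight a) :> fpoly.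
Proof.
move=> a_gt0; have Ua := @macmahon_den_unit {poly rat} 'q a erefl a_gt0.
rewrite mulrDr mulr1 /part_weight [X in _ = _ + X]mulrCA
  [_ * (_ / _)]mulrC divrK ?unitrX //.
rewrite mulnC exprM.
have -> : ('X^2 - 2%:R)%:S = ('X^2)%:S - 2%:R :> fpoly.
  by rewrite fpsCD fpsCN fpsCMn.
ring.
Qed.

Lemma theta_sum0 : theta_sum 0 = 1.
Proof.
by rewrite /theta_sum big_ord1 qbin0 mul1r /theta_term subrr chebhalf0 expr0 mul1r.
Qed.

Lemma theta_sum1 : theta_sum 1 = 'X%:S.
Proof.
rewrite /theta_sum big_ord_recl big_ord1 lift0 qbinS !qbin0 qbin_small // mulr0 addr0.
rewrite /theta_term (_ : (2 * 0)%:Z - 1 = - 1) // (_ : (2 * 1)%:Z - 1 = 1) //.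
rewrite !mul1r -fpsCD chebhalfN chebhalf1.
by rewrite -scalerDl (_ : _ + _ = 1) ?scale1r.
Qed.

Lemma theta_sumSS_weight m :
  theta_sum m.+2
  = (1 - 'q ^+ m.+1) ^+ 2 * (1 + ('X^2)%:S * part_weight m.+1) * theta_sum m.
Proof. by rewrite theta_sumSS triple_factor // mulrC. Qed.

Lemma theta_sum_even N :
  theta_sum (2 * N)
  = odd_qfact _ N ^+ 2
    * \prod_(j < N) (1 + ('X^2)%:S * part_weight (2 * j).+1).
Proof.
elim: N => [|N IHN].
  by rewrite muln0 theta_sum0 /odd_qfact [in X in X ^+ 2]big_ord0 big_ord0 expr1n mul1r.
have -> : odd_qfact _ N.+1 = odd_qfact _ N * (1 - 'q ^+ (2 * N).+1) :> fpoly.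
  by rewrite /odd_qfact big_ord_recr.
rewrite mulnS add2n theta_sumSS_weight IHN big_ord_recr /=.
by move: (odd_qfact _ _) ('q ^+ _) (part_weight _) => O u w; ring.
Qed.

Lemma theta_sum_odd N :
  theta_sum (2 * N).+1
  = 'X%:S * qfact ('q ^+ 2) N ^+ 2
    * \prod_(j < N) (1 + ('X^2)%:S * part_weight (2 * j).+2).
Proof.
elim: N => [|N IHN].
  by rewrite muln0 theta_sum1 qfact0 big_ord0 expr1n !mulr1.
rewrite mulnS add2n theta_sumSS_weight IHN big_ord_recr qfactS -exprM mulnS add2n /=.
by move: (qfact _ _) ('q ^+ _) (part_weight _) => O u w; ring.
Qed.

End TripleProduct.

(** * Sums over increasing chains *)

Section ChainSums.
Variable R : comNzRingType.
Variable a : nat -> {fps R}.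
Hypothesis a_lt : forall j i, (i < j)%N -> (a j).@[i] = 0.

(** The k-th elementary symmetric function of a 1, a 2, ...; MacMahon's sums are
    the cases a j = part_weight (2 j) and a j = part_weight (2 j - 1). *)
Definition chain_sum (k : nat) : {fps R} :=
  fps_sum (chains (k := k)) (fun m => \prod_(i < k) a (tnth m i)).

(** The increasing enumeration of a k-element subset of {1, ..., N}; the shift by
    one is there because ordinals start at 0, while the entries of a chain are
    positive.  The default tuple covers the sets of a different cardinality. *)
Definition chain_of_set N k (A : {set 'I_N}) : k.-tuple nat :=
  insubd [tuple 0%N | _ < k] [seq (val j).+1 | j <- enum A].

Lemma val_chain_of_set N k (A : {set 'I_N}) : #|A| = k ->
  val (chain_of_set k A) = [seq (val j).+1 | j <- enum A].
Proof. by move=> Ak; rewrite val_insubd size_map -cardE Ak eqxx. Qed.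

Lemma chain_of_set_bij N k :
  set_bij [set A : {set 'I_N} | #|A| = k]
    (chains (k := k) `&` [set m : k.-tuple nat | forall x, x \in m -> (x <= N)%N])
    (chain_of_set k).
Proof.
have sorted_enum (A : {set 'I_N}) : path ltn 0 [seq (val j).+1 | j <- enum A].
  have: sorted ltn (map val (enum A)).
    rewrite -[enum _](eq_filter (mem_enum _)) -(eq_filter (mem_map val_inj _)).
    by rewrite -filter_map (sorted_filter ltn_trans) // -enumT val_enum_ord iota_ltn_sorted.
  by rewrite (path_sortedE ltn_trans) all_map all_predT /= !sorted_map.
split.
- move=> A Ak; split; first by rewrite /chains /= val_chain_of_set.
  move=> x; rewrite -[x \in _]/(x \in val (chain_of_set k A)) val_chain_of_set //.
  by case/mapP => j _ ->; apply: ltn_ord.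
- move=> A B; rewrite !inE => Ak Bk /(congr1 val).
  rewrite !val_chain_of_set // => eqAB; rewrite -(set_enum A) -(set_enum B).
  have valS_inj : injective (fun j : 'I_N => (val j).+1) by move=> i j [] /val_inj.
  by rewrite (inj_map valS_inj eqAB).
- move=> m [m_chain m_le].
  pose A : {set 'I_N} := [set j : 'I_N | (val j).+1 \in m]%SET.
  have m_enum : [seq (val j).+1 | j <- enum A] = m.
    have sA := path_sorted (sorted_enum A); have sm := path_sorted m_chain.
    apply: (irr_sorted_eq ltn_trans ltnn sA sm).
    move=> x; apply/mapP/idP => [[j]|xm]; first by rewrite mem_enum inE => ? ->.
    have x_gt0 : (0 < x)%N by have/tnthP[i ->] := xm; apply: chains_gt0.
    have lt_xN : (x.-1 < N)%N by rewrite prednK // m_le.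
    by exists (Ordinal lt_xN); rewrite ?mem_enum ?inE /= prednK.
  have Ak : #|A| = k.
    by rewrite cardE -(size_map (fun j : 'I_N => (val j).+1)) m_enum size_tuple.
  by exists A => //; apply: val_inj; rewrite val_chain_of_set.
Qed.

Lemma coef_prod_chain k (m : k.-tuple nat) i n : (n < tnth m i)%N ->
  (\prod_(j < k) a (tnth m j)).@[n] = 0.
Proof.
move=> lt_nm; have -> : \prod_(j < k) a (tnth m j)
  = a (tnth m i) * \prod_(j < k | j != i) a (tnth m j) by rewrite (bigD1 i).
by rewrite (@coef_fpsM_lt _ _ _ (tnth m i) 0) ?addn0 // => j; apply: a_lt.
Qed.

(** A chain with an entry above N contributes only from q^(N+1) on, and the
    remaining chains are the subsets of {1, ..., N}. *)
Lemma eqmodq_chain_sum N k :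
  eqmodq N.+1 (chain_sum k)
    (\sum_(A : {set 'I_N} | #|A| == k) \prod_(j in A) a (val j).+1).
Proof.
move=> n; rewrite ltnS => le_nN; rewrite coef_fps_sum /=.
rewrite -(@fsbig_widen _ _ _ _
  (chains (k := k) `&` [set m : k.-tuple nat | forall x, x \in m -> (x <= N)%N])); first last.
- move=> m [m_chain m_big] /=; apply: contrapT => mn0.
  apply: m_big; split=> // x /tnthP[i ->].
  rewrite leqNgt; apply/negP => lt_Nm; apply: mn0; apply: (coef_prod_chain (i := i)).
  exact: leq_ltn_trans lt_Nm.
- by move=> m [].
rewrite (@reindex_fsbig _ _ _ {set 'I_N} (k.-tuple nat) _ _ _ _ (chain_of_set_bij N k)).
rewrite [RHS]bigfs ?index_enum_uniq //; last by move=> A _; rewrite mem_index_enum.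
have -> : [set A : {set 'I_N} | #|A| = k] = [set` (fun A : {set 'I_N} => #|A| == k)].
  by apply/seteqP; split=> A /=; rewrite -topredE /= => /eqP.
apply: eq_fsbigr => A /set_mem /= /eqP Ak.
rewrite -(big_tuple _ _ (chain_of_set k A) xpredT a) /= val_chain_of_set //.
by rewrite big_map big_enum.
Qed.

(** Expand the product over subsets and group these by cardinality. *)
Lemma eqmodq_prod_chain_sum N (x : {fps R}) :
  eqmodq N.+1 (\prod_(j < N) (1 + x * a j.+1)) (\sum_(k < N.+1) chain_sum k * x ^+ k).
Proof.
have -> : \prod_(j < N) (1 + x * a j.+1)
  = \sum_(k < N.+1)
      (\sum_(A : {set 'I_N} | #|A| == k) \prod_(j in A) a (val j).+1) * x ^+ k.
  rewrite (eq_bigr (fun j : 'I_N => x * a j.+1 + 1)); last by move=> j _; rewrite addrC.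
  rewrite bigA_distr.
  rewrite (partition_big (fun A : {set 'I_N} => inord #|A| : 'I_N.+1) xpredT) //=.
  apply: eq_bigr => k _; rewrite mulr_suml; apply: eq_big => A.
    by rewrite -val_eqE /= inordK // ltnS -[X in (_ <= X)%N]card_ord max_card.
  rewrite -val_eqE /= inordK; last by rewrite ltnS -[X in (_ <= X)%N]card_ord max_card.
  move=> /eqP <-; rewrite -big_mkcond big_split /= prodr_const mulrC.
  by congr (_ * _).
apply: eqmodq_sum => k _; apply: eqmodqM => //; exact/eqmodq_sym/eqmodq_chain_sum.
Qed.

End ChainSums.

(** * Limits of the finite identities *)

Section QPochLimits.
Variable R : comUnitRingType.
Implicit Types y : {fps R}.

Lemma qpoch_inf_unit (a y : {fps R}) : a.@[0] = 0 -> y.@[0] = 0 ->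
  qpoch_inf a y \is a GRing.unit.
Proof.
move=> a0 y0; rewrite fps_unitE (eqmodq_qpoch_inf a (N := 1) y0) // big_ord1.
by rewrite coef_fpsB coef0_fpsM a0 mul0r subr0 unitr1.
Qed.

Lemma eqmodq_qfact y n k : y.@[0] = 0 -> (n <= k)%N ->
  eqmodq n (qpoch_inf y y) (qfact y k).
Proof. by move=> y0 le_nk; apply: eqmodq_leq le_nk _; apply: eqmodq_qpoch_inf. Qed.

(** By the quotient formula, the coefficient is (y;y)_m divided by
    (y;y)_k (y;y)_(m-k), and each of the three products agrees with (y;y)_oo
    modulo q^n. *)
Lemma eqmodq_qbin y n m k : y.@[0] = 0 -> (n <= k)%N -> (n + k <= m)%N ->
  eqmodq n (qpoch_inf y y * qbin y m k) 1.
Proof.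
move=> y0 le_nk le_nkm; apply: (eqmodq_cancel (qpoch_inf_unit y0 y0)).
apply: (eqmodq_trans (g := qfact y k * (qfact y (m - k) * qbin y m k))).
  apply: eqmodqM; first exact: eqmodq_qfact.
  apply: eqmodqM; last exact: eqmodq_refl.
  by apply: eqmodq_qfact => //; lia.
rewrite mulrA qbin_qfact; last by lia.
by rewrite mulr1; apply: eqmodq_sym; apply: eqmodq_qfact => //; lia.
Qed.

Lemma qfact_odd_even N :
  qfact 'q (2 * N) = qfact ('q ^+ 2) N * odd_qfact R N.
Proof.
elim: N => [|N IHN]; first by rewrite muln0 !qfact0 mul1r /odd_qfact big_ord0.
have -> : odd_qfact R N.+1 = odd_qfact R N * (1 - 'q ^+ (2 * N).+1).
  by rewrite /odd_qfact big_ord_recr.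
have -> : (2 * N.+1 = (2 * N).+2)%N by lia.
rewrite !qfactS IHN -exprM.
have -> : (2 * N.+1 = (2 * N).+2)%N by lia.
by move: ('q ^+ _) ('q ^+ _) => u w; ring.
Qed.

(** This is (q;q)_N (-q;q)_N = (q^2;q^2)_N, factor by factor. *)
Lemma qfact_diff_squares N :
  qfact 'q N * \prod_(j < N) (1 - (- 'q) * 'q ^+ j) = qfact ('q ^+ 2 : {fps R}) N.
Proof.
elim: N => [|N IHN]; first by rewrite !qfact0 mul1r big_ord0.
rewrite !qfactS -IHN [in LHS]big_ord_recr /= mulNr -exprS exprAC.
by move: ('q ^+ _) => u; ring.
Qed.

(** From (q;q)_oo = (q^2;q^2)_oo (q;q^2)_oo and
    (q;q)_oo (-q;q)_oo = (q^2;q^2)_oo one gets the two factors (q;q)_oo and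
    (q;q^2)_oo = 1 / (-q;q)_oo of the left-hand side.  At finite level the
    congruence is first multiplied by the units (-q;q)_oo and (q^2;q^2)_oo. *)
Lemma eqmodq_odd_qfact n N : (n <= N)%N ->
  eqmodq n (qpoch_inf ('q ^+ 2) ('q ^+ 2) * odd_qfact R N ^+ 2)
    (qpoch_inf 'q 'q / qpoch_inf (- 'q) 'q).
Proof.
move=> le_nN; have q0 : ('q : {fps R}).@[0] = 0 by [].
have p0 : ('q ^+ 2 : {fps R}).@[0] = 0 by rewrite coef_fpsX_lt.
have le_n2N : (n <= 2 * N)%N by lia.
set P := qpoch_inf ('q ^+ 2) _; set Q := qpoch_inf 'q 'q; set M := qpoch_inf (- 'q) 'q.
pose v := \prod_(j < 2 * N) (1 - (- 'q) * 'q ^+ j) : {fps R}.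
have UM : M \is a GRing.unit by rewrite qpoch_inf_unit // coef_fpsN q0 oppr0.
have UP : P \is a GRing.unit by apply: qpoch_inf_unit.
have Mv : eqmodq n M v.
  by apply: eqmodq_leq le_n2N _; apply: eqmodq_qpoch_inf.
have PN : eqmodq n P (qfact ('q ^+ 2) N) by apply: eqmodq_qfact.
have P2N : eqmodq n P (qfact ('q ^+ 2) (2 * N)) by apply: eqmodq_qfact.
have Q2N : eqmodq n Q (qfact 'q (2 * N)) by apply: eqmodq_qfact.
(* From here on only the congruences matter; opaque names keep unification from
   unfolding the infinite products. *)
clearbody P Q M.
apply: (eqmodq_cancel UM); rewrite [M * (Q / M)]mulrC divrK //.
apply: (eqmodq_cancel UP).
have -> : P * (M * (P * odd_qfact R N ^+ 2))
        = (P * odd_qfact R N) * ((P * odd_qfact R N) * M) by ring.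
apply: (eqmodq_trans (g := qfact 'q (2 * N) * (qfact 'q (2 * N) * v))).
  have PO : eqmodq n (P * odd_qfact R N) (qfact 'q (2 * N)).
    by rewrite qfact_odd_even; apply: eqmodqM.
  by apply: eqmodqM => //; apply: eqmodqM.
rewrite qfact_diff_squares mulrC; apply: eqmodq_sym; exact: eqmodqM.
Qed.

End QPochLimits.

Section ThetaLimit.
Variable R : realType.

Lemma theta_term_small d n : (2 * n <= `|d|)%N -> eqmodq n (theta_term R d) 0.
Proof.
move=> le_nd; apply: eqmodq0M; apply: eqmodqXn0 => //.
rewrite leq_divRL // mulnC; apply: leq_trans (_ : (2 * n) ^ 2 <= _)%N;
  last by rewrite leq_exp2r.
by rewrite expnMn leq_mul2l /= -mulnn; case: n {le_nd} => // n; rewrite leq_pmulr.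
Qed.

(** The limit of the finite triple product.  If k or m - k is less than n, then
    |2k - m| > m - 2n >= 2n, and the summand vanishes modulo q^n whatever the
    binomial coefficient is; otherwise [eqmodq_qbin] applies. *)
Lemma eqmodq_theta_sum n m : (4 * n <= m)%N ->
  eqmodq n (qpoch_inf ('q ^+ 2) ('q ^+ 2) * theta_sum R m)
    (\sum_(k < m.+1) theta_term R ((2 * k)%:Z - m%:Z)).
Proof.
move=> le_nm; rewrite /theta_sum mulr_sumr; apply: eqmodq_sum => -[k /=] + _.
rewrite ltnS => le_km; rewrite mulrA -[X in eqmodq _ _ X]mul1r.
have [/andP[le_nk le_nkm] | /nandP far] := boolP ((n <= k) && (n + k <= m))%N.
  by apply: eqmodqM => //; apply: eqmodq_qbin => //; rewrite coef_fpsX_lt.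
have small : eqmodq n (theta_term R ((2 * k)%:Z - m%:Z)) 0.
  by apply: theta_term_small; lia.
apply: (eqmodq_trans (g := 0)); first by rewrite mulrC; apply: eqmodq0M.
by rewrite mul1r; apply: eqmodq_sym.
Qed.

Lemma theta_termN d : theta_term R (- d) = theta_term R d.
Proof. by rewrite /theta_term abszN chebhalfN. Qed.

(** Going from m to m + 2 adds the terms at d = m + 2 and d = - (m + 2), which are
    equal; this folds the bilateral sums into the one-sided ones. *)
Lemma sum_theta_termSS m :
  \sum_(k < m.+3) theta_term R ((2 * k)%:Z - m.+2%:Z)
  = \sum_(k < m.+1) theta_term R ((2 * k)%:Z - m%:Z) + 2%:R * theta_term R m.+2%:Z.
Proof.
rewrite big_ord_recl big_ord_recr /=.
rewrite muln0 sub0r theta_termN.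
have -> : (2 * bump 0 m.+1)%:Z - m.+2%:Z = m.+2%:Z by rewrite /bump; lia.
rewrite (eq_bigr (fun k : 'I_m.+1 => theta_term R ((2 * k)%:Z - m%:Z))); first by ring.
by move=> k _; congr (theta_term R _); rewrite /bump /=; lia.
Qed.

Lemma sum_theta_term_even N :
  \sum_(k < (2 * N).+1) theta_term R ((2 * k)%:Z - (2 * N)%:Z)
  = 1 + 2%:R * \sum_(k < N) theta_term R (2 * k.+1)%:Z.
Proof.
elim: N => [|N IHN].
  by rewrite big_ord1 subrr /theta_term chebhalf0 expr0 mul1r big_ord0 mulr0 addr0.
rewrite mulnS add2n sum_theta_termSS IHN big_ord_recr /= mulrDr addrA.
by rewrite mulnS add2n.
Qed.

Lemma sum_theta_term_odd N :
  \sum_(k < (2 * N).+2) theta_term R ((2 * k)%:Z - (2 * N).+1%:Z)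
  = 2%:R * \sum_(k < N.+1) theta_term R (2 * k).+1%:Z.
Proof.
elim: N => [|N IHN].
  rewrite big_ord_recl !big_ord1 lift0 -[theta_term R (_ - _)]theta_termN
    mulr2n mulrDl mul1r.
  by congr (theta_term R _ + theta_term R _).
rewrite mulnS add2n sum_theta_termSS IHN [in RHS]big_ord_recr /= mulrDr.
by rewrite mulnS add2n.
Qed.

Lemma seriesF_theta n N : (n <= N.+1)%N ->
  eqmodq n (seriesF R) (2%:R * \sum_(k < N.+1) theta_term R (2 * k).+1%:Z).
Proof.
move=> le_nN; apply: eqmodqM => //.
apply: eqmodq_trans; first apply: eqmodq_leq le_nN _; first apply: eqmodq_fps_sum.
  move=> k i lt_ik; rewrite coef_fpsCM coef_fpsX_lt ?mulr0 //.
  by rewrite (leq_trans lt_ik) // leq_addl.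
rewrite (eq_bigl xpredT) => [|k]; last exact: mem_set.
apply: eqmodq_sum => k _; rewrite /theta_term /chebhalf /chebz /= addn1 mulrC.
by rewrite (_ : ((2 * k).+1 ^ 2 %/ 4 = k ^ 2 + k)%N) //; lia.
Qed.

Lemma seriesG_theta n N : (n <= N)%N ->
  eqmodq n (seriesG R) (1 + 2%:R * \sum_(k < N) theta_term R (2 * k.+1)%:Z).
Proof.
move=> le_nN; apply: eqmodqD => //; apply: eqmodqM => //.
apply: eqmodq_trans.
  apply: (eqmodq_leq (leq_trans le_nN (leqnSn _))); apply: eqmodq_fps_sum.
  move=> k i lt_ik; rewrite coef_fpsCM coef_fpsX_lt ?mulr0 //.
  by rewrite (leq_trans lt_ik) // -mulnn leq_pmulr // (leq_trans _ lt_ik).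
rewrite big_mkcond big_ord_recl /= ifF ?add0r; last by apply/negP => /set_mem.
apply: eqmodq_sum => k _; rewrite ifT; last exact: mem_set.
rewrite /theta_term /chebhalf /chebz /bump leq0n add1n mulrC.
by rewrite (_ : ((2 * k.+1) ^ 2 %/ 4 = k.+1 ^ 2)%N) // expnMn mulKn.
Qed.

End ThetaLimit.

(** * The generating functions *)

Lemma part_weight_lt a i : (i < a)%N -> (part_weight a).@[i] = 0.
Proof.
move=> lt_ia; apply: (@coef_fpsM_lt _ _ _ a 0); rewrite ?addn0 //.
by move=> j; apply: coef_fpsX_lt.
Qed.

(** Positivity of the e i makes the denominators invertible. *)
Lemma prod_part_weight (k : nat) (e : 'I_k -> nat) : (forall i, 0 < e i)%N ->
  \prod_(i < k) part_weight (e i)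
  = 'q ^+ (\sum_(i < k) e i)%N / \prod_(i < k) (1 - 'q ^+ e i) ^+ 2.
Proof.
move=> e_gt0; rewrite big_split prodrXr; congr (_ * _).
by apply: prodrV => i _; rewrite unitrX // macmahon_den_unit.
Qed.

Lemma macmahonA_chain_sum k :
  macmahonA k ('q ^+ 2 : {fps {poly rat}}) = chain_sum (fun j => part_weight (2 * j)) k.
Proof.
apply: fpsP => n; apply: eq_fsbigr => m /set_mem m_chain; congr (_.@[n]).
rewrite prod_part_weight => [|i]; last by rewrite muln_gt0 (chains_gt0 i m_chain).
rewrite /termA -big_distrr /= exprM; congr (_ / _).
by apply: eq_bigr => i _; rewrite exprM.
Qed.

(** On a chain every 2 m_i is at least 1, so the truncated exponent is the sum of
    the 2 m_i - 1. *)
Lemma macmahonC_chain_sum k :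
  macmahonC k ('q : {fps {poly rat}}) = chain_sum (fun j => part_weight (2 * j - 1)) k.
Proof.
apply: fpsP => n; apply: eq_fsbigr => m /set_mem m_chain; congr (_.@[n]).
have m_gt0 := fun i => chains_gt0 i m_chain.
have gt1_double t : (0 < t -> 1 < 2 * t)%N by lia.
rewrite prod_part_weight => [|i]; last by rewrite subn_gt0; exact/gt1_double/m_gt0.
rewrite /termC sumnB => [|i _]; first by rewrite sum_nat_const card_ord muln1.
exact/ltnW/gt1_double/m_gt0.
Qed.

Lemma eqmodq_prodA n N : (n <= N.+1)%N ->
  eqmodq n ('X%:S * \prod_(j < N) (1 + ('X^2)%:S * part_weight (2 * j).+2))
    (fps_sum [set: nat] (fun k : nat =>
       macmahonA k ('q ^+ 2 : {fps {poly rat}}) * ('X ^+ (2 * k + 1))%:S)).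
Proof.
move=> le_nN; apply: (eqmodq_leq le_nN); apply: eqmodq_sym.
apply: eqmodq_trans; first apply: eqmodq_fps_sum.
  move=> k i lt_ik; apply: (@coef_fpsM_lt _ _ _ k 0); rewrite ?addn0 // => j.
  by apply: macmahonA_lt; rewrite coef_fpsX_lt.
rewrite (eq_bigl xpredT) => [|k]; last exact: mem_set.
apply: eqmodq_sym.
have -> : \sum_(k < N.+1) macmahonA k ('q ^+ 2) * ('X ^+ (2 * k + 1))%:S
  = 'X%:S * \sum_(k < N.+1) chain_sum (fun j => part_weight (2 * j)) k * ('X^2)%:S ^+ k.
  rewrite mulr_sumr; apply: eq_bigr => k _.
  by rewrite macmahonA_chain_sum addn1 exprS exprM fpsCM [in LHS]fpsCX mulrCA.
apply: eqmodqM => //.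
rewrite (eq_bigr (fun j : 'I_N => 1 + ('X^2)%:S * part_weight (2 * j.+1))).
  apply: (@eqmodq_prod_chain_sum _ (fun j => part_weight (2 * j))).
  by move=> j i lt_ij; apply: part_weight_lt; lia.
by move=> j _; rewrite mulnS.
Qed.

Lemma eqmodq_prodC n N : (n <= N.+1)%N ->
  eqmodq n (\prod_(j < N) (1 + ('X^2)%:S * part_weight (2 * j).+1))
    (fps_sum [set: nat] (fun k : nat =>
       macmahonC k ('q : {fps {poly rat}}) * ('X ^+ (2 * k))%:S)).
Proof.
move=> le_nN; apply: (eqmodq_leq le_nN); apply: eqmodq_sym.
apply: eqmodq_trans; first apply: eqmodq_fps_sum.
  move=> k i lt_ik; apply: (@coef_fpsM_lt _ _ _ k 0); rewrite ?addn0 // => j.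
  exact: macmahonC_lt.
rewrite (eq_bigl xpredT) => [|k]; last exact: mem_set.
apply: eqmodq_sym.
have -> : \sum_(k < N.+1) macmahonC k 'q * ('X ^+ (2 * k))%:S
  = \sum_(k < N.+1) chain_sum (fun j => part_weight (2 * j - 1)) k * ('X^2)%:S ^+ k.
  by apply: eq_bigr => k _; rewrite macmahonC_chain_sum exprM fpsCX.
rewrite (eq_bigr (fun j : 'I_N => 1 + ('X^2)%:S * part_weight (2 * j.+1 - 1))).
  apply: (@eqmodq_prod_chain_sum _ (fun j => part_weight (2 * j - 1))).
  by move=> j i lt_ij; apply: part_weight_lt; lia.
by move=> j _; rewrite mulnS subn1.
Qed.

Theorem theorem1 (R : realType) :
  seriesF R
    = qpoch_inf ('q ^+ 2) ('q ^+ 2) ^+ 3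
      * fps_sum [set: nat] (fun k : nat =>
          macmahonA k ('q ^+ 2 : {fps {poly rat}}) * ('X ^+ (2 * k + 1))%:S)
  /\
  seriesG R
    = qpoch_inf 'q 'q / qpoch_inf (- 'q) 'q
      * fps_sum [set: nat] (fun k : nat =>
          macmahonC k ('q : {fps {poly rat}}) * ('X ^+ (2 * k))%:S).
Proof.
have p0 : ('q ^+ 2 : {fps {poly rat}}).@[0] = 0 by rewrite coef_fpsX_lt.
(* N = 2n makes the size 2N or 2N + 1 of the finite identities at least 4n. *)
split; apply: eqmodqP => n; pose N := (2 * n)%N; have le_nN : (n <= N)%N by lia.
- apply: (eqmodq_trans (seriesF_theta R (leqW le_nN))); rewrite -sum_theta_term_odd.
  apply: (eqmodq_trans (eqmodq_sym (@eqmodq_theta_sum R n (2 * N).+1 _))); first by lia.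
  rewrite theta_sum_odd; set P := qpoch_inf _ _.
  have := eqmodq_prodA (leqW le_nN); set W := \prod_(j < N) _ => WN.
  have PN : eqmodq n (qfact ('q ^+ 2) N) P.
    by apply: eqmodq_sym; apply: eqmodq_qfact.
  clearbody W P.
  have -> : P * ('X%:S * qfact ('q ^+ 2) N ^+ 2 * W)
          = P * qfact ('q ^+ 2) N ^+ 2 * ('X%:S * W) by ring.
  rewrite [P ^+ 3]exprS; do 2!apply: eqmodqM => //; exact: eqmodqX.
- apply: (eqmodq_trans (seriesG_theta R le_nN)); rewrite -sum_theta_term_even.
  apply: (eqmodq_trans (eqmodq_sym (@eqmodq_theta_sum R n (2 * N) _))); first by lia.
  have := eqmodqM (eqmodq_odd_qfact {poly rat} le_nN) (eqmodq_prodC (leqW le_nN)).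
  by rewrite theta_sum_even -mulrA.
Qed.
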